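(* Given a dynamic path $P$ with $|P|=n+1$ vertices (as in the context), there is an algorithm running in $O(|P|\log|P|)$ time that computes $\Theta^1(P)$ together with a point $x^*\in[x_0,x_n]$ such that $\Theta^1(P)=\max(\Theta_L(P,x^* ),\Theta_R(P,x^* ))$.
   Context: A dynamic path $P$ consists of real points (vertices) $x_0<x_1<\dots<x_n$, edges $e_i=(x_{i-1},x_i)$ for $1\le i\le n$, a constant $\tau>0$ (the time needed to travel one unit of distance) such that every $|x_i-x_j|\tau$ is an integer, nonnegative integer weights $w_i$ (the number of people initially at $x_i$), and positive integer capacities $c_i$ (of edge $e_i$); $|P|=n+1$. Discrete evacuation model: a sink $x\in[x_0,x_n]$ (any point, not necessarily a vertex) is fixed and every person moves along the path toward $x$. Time is discrete. At each vertex, people wanting to enter the next edge toward the sink wait in a first-in-first-out queue; at each integer time step at most $c_i$ people may enter edge $e_i$, and people enter as soon as capacity and the queue permit. A group of people covers distance $d$ in time $d\tau$; on reaching the far vertex of an edge they join that vertex's queue (or reach the sink if it lies on the edge). People starting at $x$ are evacuated at time $0$. $\Theta_L(P,x)$ (resp. $\Theta_R(P,x)$) is the time at which all people starting on vertices strictly left (resp. right) of $x$ have reached $x$. $\Theta(P,x)=\max(\Theta_L(P,x),\Theta_R(P,x))$ and $\Theta^1(P)=\min_{x\in[x_0,x_n]}\Theta(P,x)$ (the minimum 1-sink evacuation time). *)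

(* Defs.v *)
From mathcomp Require Import all_boot all_order all_algebra.
From mathcomp Require Import classical_sets reals.

Set Implicit Arguments.
Unset Strict Implicit.
Unset Printing Implicit Defensive.

Import Order.TTheory GRing.Theory Num.Theory.
Local Open Scope ring_scope.

(* In 0-based indexing, [nth 0%N (cap P) i] is the capacity of the edge from
   vertex [i] to vertex [i.+1]. *)
Record dynpath (R : realType) := DynPath {
  nedges : nat;
  pos : nedges.+1.-tuple R;
  wgt : nedges.+1.-tuple nat;
  cap : nedges.-tuple nat;
  tau : R;
  pos_sorted : sorted <%R pos;
  cap_gt0 : all (leq 1) cap;
  tau_gt0 : 0 < tau;
  travel_int :
    forall i j : 'I_nedges.+1, `|tnth pos i - tnth pos j| * tau \is a Num.int
}.

Definition nverts (R : realType) (P : dynpath R) : nat := (nedges P).+1.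
Definition vpos (R : realType) (P : dynpath R) (i : nat) : R :=
  nth 0 (pos P) i.
Definition weight (R : realType) (P : dynpath R) (i : nat) : nat :=
  nth 0%N (wgt P) i.
Definition capacity (R : realType) (P : dynpath R) (i : nat) : nat :=
  nth 0%N (cap P) i.

(* The truncation is exact, by [travel_int]. *)
Definition travel (R : realType) (P : dynpath R) (i : nat) : nat :=
  Num.truncn ((vpos P i.+1 - vpos P i) * tau P).

(* A person is (starting vertex, serial number at that vertex). *)
Definition person : Type := (nat * nat)%type.

(* The queue at a vertex at integer time [t], just before the people allowed
   to leave at time [t] do so: newcomers at time [t] are already in it (at the
   back), the front is the head of the list, and [c] people may leave per time
   step. *)
Fixpoint queue (c : nat) (joins : nat -> seq person) (t : nat) : seq person :=
  match t with
  | 0%N => joins 0%N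
  | t'.+1 => drop c (queue c joins t') ++ joins t'.+1
  end.

(* One-way motion along vertices 0, 1, 2, ... away from vertex 0, with [w i]
   residents at vertex [i], and capacity [c i] and travel time [d i] on the
   edge from [i] to [i.+1]. The motion at vertex [i] depends only on the
   vertices up to [i], hence not on where the sink is beyond them. *)

(* People who join the queue of vertex [i] at time [t]. *)
Fixpoint joining (w c d : nat -> nat) (i t : nat) {struct i} : seq person :=
  (if t == 0%N then [seq (i, j) | j <- iota 0 (w i)] else [::]) ++
  match i with
  | 0%N => [::]
  | k.+1 => if (d k <= t)%N
            then take (c k) (queue (c k) (joining w c d k) (t - d k)%N)
            else [::]
  end.

(* People who enter the edge from [i] to [i.+1] at time [t]. *)
Definition entering (w c d : nat -> nat) (i t : nat) : seq person :=
  take (c i) (queue (c i) (joining w c d i) t).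

Definition entering_right (R : realType) (P : dynpath R) : nat -> nat -> seq person :=
  entering (weight P) (capacity P) (travel P).

(* Leftward motion: vertices are renumbered from the right end, vertex [i]
   becoming [nedges P - i]. *)
Definition entering_left (R : realType) (P : dynpath R) : nat -> nat -> seq person :=
  let n := nedges P in
  entering (fun i => weight P (n - i)%N)
           (fun i => capacity P (n - i.+1)%N)
           (fun i => travel P (n - i.+1)%N).

(* All people starting strictly left of [x] have reached [x] by time [T]; the
   edge from [k] to [k.+1] is the one through which they reach [x]. *)
Definition evacuatedL (R : realType) (P : dynpath R) (x T : R) : Prop :=
  forall i j : nat, (i < nverts P)%N -> vpos P i < x -> (j < weight P i)%N ->
  exists k t : nat,
    [/\ (k < nedges P)%N, vpos P k < x <= vpos P k.+1,
        (i, j) \in entering_right P k t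
      & t%:R + (x - vpos P k) * tau P <= T].

Definition evacuatedR (R : realType) (P : dynpath R) (x T : R) : Prop :=
  forall i j : nat, (i < nverts P)%N -> x < vpos P i -> (j < weight P i)%N ->
  exists k t : nat,
    [/\ (k < nedges P)%N, vpos P k <= x < vpos P k.+1,
        ((nedges P - i)%N, j) \in entering_left P (nedges P - k.+1)%N t
      & t%:R + (vpos P k.+1 - x) * tau P <= T].

Local Open Scope classical_set_scope.

(* The earliest admissible time; it is 0 when nobody starts strictly left of [x]. The set is a nonempty
   closed half-line for [x] in the range of the path, so the infimum is a
   minimum. *)
Definition ThetaL (R : realType) (P : dynpath R) (x : R) : R :=
  inf [set T | 0 <= T /\ evacuatedL P x T].

Definition ThetaR (R : realType) (P : dynpath R) (x : R) : R :=
  inf [set T | 0 <= T /\ evacuatedR P x T].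

Definition Theta (R : realType) (P : dynpath R) (x : R) : R :=
  Num.max (ThetaL P x) (ThetaR P x).

(* [Theta P] takes its minimum on the path, because [ThetaL P] is nondecreasing
   and left-continuous and [ThetaR P] nonincreasing and right-continuous. *)
Definition Theta1 (R : realType) (P : dynpath R) : R :=
  inf [set Theta P x | x in [set x | vpos P 0 <= x <= vpos P (nedges P)]].

Local Close Scope classical_set_scope.

(* A unit-cost real RAM, programmed in a structured imperative language.
   The store consists of arrays of natural numbers and arrays of reals, array
   names being natural-number constants of the program and indices computed at
   run time. Real arithmetic and comparison are exact; there is no conversion
   from reals to integers. Multiplication of natural numbers is not primitive,
   so that an operation at most doubles the largest number present and long
   computations cannot be packed into single integers by repeated squaring. *)

Inductive nexpr : Type :=
| NConst of nat
| NLoad of nat & nexpr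
| NAdd of nexpr & nexpr
| NSub of nexpr & nexpr
| NDiv of nexpr & nexpr.

Inductive rexpr : Type :=
| ROfNat of nexpr
| RLoad of nat & nexpr
| RAdd of rexpr & rexpr
| RSub of rexpr & rexpr
| RMul of rexpr & rexpr
| RDiv of rexpr & rexpr.

Inductive bexpr : Type :=
| NLe of nexpr & nexpr
| RLe of rexpr & rexpr
| BNot of bexpr
| BAnd of bexpr & bexpr.

Inductive cmd : Type :=
| Skip
| NStore of nat & nexpr & nexpr
| RStore of nat & nexpr & rexpr
| Seq of cmd & cmd
| If of bexpr & cmd & cmd
| While of bexpr & cmd.

Record store (R : realType) := Store {
  nmem : nat -> nat -> nat;
  rmem : nat -> nat -> R
}.

Definition upd (T : Type) (m : nat -> nat -> T) (a i : nat) (v : T) :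
    nat -> nat -> T :=
  fun a' i' => if (a' == a) && (i' == i) then v else m a' i'.

(* Subtraction is truncated, and division is rounded down. *)
Fixpoint neval (R : realType) (s : store R) (e : nexpr) : nat :=
  match e with
  | NConst n => n
  | NLoad a e1 => nmem s a (neval s e1)
  | NAdd e1 e2 => neval s e1 + neval s e2
  | NSub e1 e2 => neval s e1 - neval s e2
  | NDiv e1 e2 => neval s e1 %/ neval s e2
  end%N.

Fixpoint reval (R : realType) (s : store R) (e : rexpr) : R :=
  match e with
  | ROfNat e1 => (neval s e1)%:R
  | RLoad a e1 => rmem s a (neval s e1)
  | RAdd e1 e2 => reval s e1 + reval s e2
  | RSub e1 e2 => reval s e1 - reval s e2
  | RMul e1 e2 => reval s e1 * reval s e2
  | RDiv e1 e2 => reval s e1 / reval s e2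
  end.

Fixpoint beval (R : realType) (s : store R) (b : bexpr) : bool :=
  match b with
  | NLe e1 e2 => (neval s e1 <= neval s e2)%N
  | RLe e1 e2 => reval s e1 <= reval s e2
  | BNot b1 => ~~ beval s b1
  | BAnd b1 b2 => beval s b1 && beval s b2
  end.

(* Evaluating an expression costs one unit per node. *)
Fixpoint ncost (e : nexpr) : nat :=
  match e with
  | NConst _ => 1
  | NLoad _ e1 => (ncost e1).+1
  | NAdd e1 e2 | NSub e1 e2 | NDiv e1 e2 => (ncost e1 + ncost e2).+1
  end%N.

Fixpoint rcost (e : rexpr) : nat :=
  match e with
  | ROfNat e1 | RLoad _ e1 => (ncost e1).+1
  | RAdd e1 e2 | RSub e1 e2 | RMul e1 e2 | RDiv e1 e2 =>
      (rcost e1 + rcost e2).+1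
  end%N.

Fixpoint bcost (b : bexpr) : nat :=
  match b with
  | NLe e1 e2 => (ncost e1 + ncost e2).+1
  | RLe e1 e2 => (rcost e1 + rcost e2).+1
  | BNot b1 => (bcost b1).+1
  | BAnd b1 b2 => (bcost b1 + bcost b2).+1
  end%N.

(* [exec p s s' k]: started in [s], the program [p] halts in [s'] after
   [k] units of time. *)
Inductive exec (R : realType) : cmd -> store R -> store R -> nat -> Prop :=
| exec_skip s :
    exec Skip s s 1
| exec_nstore a ei ev s :
    exec (NStore a ei ev) s
         (Store (upd (nmem s) a (neval s ei) (neval s ev)) (rmem s))
         (ncost ei + ncost ev).+1
| exec_rstore a ei ev s :
    exec (RStore a ei ev) s
         (Store (nmem s) (upd (rmem s) a (neval s ei) (reval s ev)))
         (ncost ei + rcost ev).+1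
| exec_seq p q s s1 s2 k1 k2 :
    exec p s s1 k1 -> exec q s1 s2 k2 -> exec (Seq p q) s s2 (k1 + k2)
| exec_if b p q s s1 k :
    exec (if beval s b then p else q) s s1 k ->
    exec (If b p q) s s1 (bcost b + k).+1
| exec_while_done b p s :
    ~~ beval s b -> exec (While b p) s s (bcost b).+1
| exec_while_loop b p s s1 s2 k1 k2 :
    beval s b -> exec p s s1 k1 -> exec (While b p) s1 s2 k2 ->
    exec (While b p) s s2 (bcost b + k1 + k2).+1.

Lemma exec_det (R : realType) (p : cmd) (s s1 s2 : store R) (k1 k2 : nat) :
  exec p s s1 k1 -> exec p s s2 k2 -> s1 = s2 /\ k1 = k2.
Proof.
move=> E1; elim: E1 s2 k2 => {p s s1 k1}.
- by move=> s s2 k2; inversion 1.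
- by move=> a ei ev s s2 k2; inversion 1.
- by move=> a ei ev s s2 k2; inversion 1.
- move=> p q s s1 s2 k1 k2 _ IH1 _ IH2 s3 k3.
  inversion 1 as [| | |p' q' s' s1' s2' k1' k2' E1 E2| | |]; subst.
  case: (IH1 _ _ E1) => ? ?; subst.
  by case: (IH2 _ _ E2) => ? ?; subst.
- move=> b p q s s1 k _ IH s2 k2.
  inversion 1 as [| | | |b' p' q' s' s1' k' E| |]; subst.
  by case: (IH _ _ E) => ? ?; subst.
- move=> b p s bN s2 k2.
  inversion 1 as [| | | | | |b' p' s' s1' s2' k1' k2' bT]; subst=> //.
  by rewrite bT in bN.
- move=> b p s s1 s2 k1 k2 bT _ IH1 _ IH2 s3 k3.
  inversion 1 as [| | | | |b' p' s' bN|b' p' s' s1' s2' k1' k2' _ E1 E2]; subst.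
    by rewrite bT in bN.
  case: (IH1 _ _ E1) => ? ?; subst.
  by case: (IH2 _ _ E2) => ? ?; subst.
Qed.

(* Input: natural-number arrays 0, 1, 2 hold the number of edges, the weights
   and the capacities; real arrays 0, 1 hold tau and the vertex positions. All
   other cells contain 0. *)
Definition input (R : realType) (P : dynpath R) : store R :=
  Store
    (fun a i => nth 0%N (nth [::] [:: [:: nedges P]; tval (wgt P); tval (cap P)] a) i)
    (fun a i => nth 0 (nth [::] [:: [:: tau P]; tval (pos P)] a) i).

(* Output: cells 0 and 1 of real array 2. *)
Definition out_time (R : realType) (s : store R) : R := rmem s 2 0.
Definition out_sink (R : realType) (s : store R) : R := rmem s 2 1.

(* Main.v *)
Require Import Defs.
From mathcomp Require Import all_boot all_order all_algebra.
From mathcomp Require Import classical_sets reals.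
From mathcomp Require Import zify ring lra.

(* On the way from vertex [i] to vertex [k] the first vertices up to [i] send
   [W_i] people through every edge [l] in between, so the last of them cannot
   leave [k] before time [dist i k + ceil(W_i / c_l) - 1], and the largest of
   these bounds is attained. Hence, for [x] in the path, [ThetaL P x] is the
   maximum of 0 and of the terms [(x - x_i) tau + ceil(W_i / c_l) - 1] over
   [i <= l] with [x_l < x] and [0 < W_i]; at a vertex a single sweep over [i]
   with a running minimum of the capacities computes it. [ThetaL P] is
   nondecreasing and [ThetaR P], which is [ThetaL] of the mirrored path, is
   nonincreasing, so a binary search with [O(log n)] sweeps finds an edge on
   which they cross. Inside this edge both are affine with slopes [tau] and
   [- tau] (truncated at 0), so the optimum is an endpoint or the crossing. *)

Set Implicit Arguments.
Unset Strict Implicit.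
Unset Printing Implicit Defensive.

Import Order.TTheory GRing.Theory Num.Theory.

(** * Departure counts *)

Definition pop (w : nat -> nat) (i : nat) : nat := \sum_(0 <= j < i.+1) w j.

Definition dist (d : nat -> nat) (i k : nat) : nat := \sum_(i <= l < k) d l.

Definition residents (w : nat -> nat) (i : nat) : seq person :=
  [seq (i, j) | j <- iota 0 (w i)].

Definition people (w : nat -> nat) (k : nat) : seq person :=
  [seq (i, j) | i <- iota 0 k.+1, j <- iota 0 (w i)].

(** Counts the times strictly before [t], as does [entered]; hence the recurring [t.+1] where time
    [t] itself is to be included. *)
Definition joined (w c d : nat -> nat) (k t : nat) : seq person :=
  flatten [seq joining w c d k s | s <- iota 0 t].

Definition entered (w c d : nat -> nat) (k t : nat) : seq person :=
  flatten [seq entering w c d k s | s <- iota 0 t].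

Lemma popS w k : pop w k.+1 = pop w k + w k.+1.
Proof. by rewrite /pop big_nat_recr. Qed.

Lemma leq_pop w i k : i <= k -> pop w i <= pop w k.
Proof.
move=> /subnKC <-; elim: (k - i) => [|m IHm]; first by rewrite addn0.
by rewrite addnS popS (leq_trans IHm) ?leq_addr.
Qed.

Lemma distS d i k : i <= k -> dist d i k.+1 = dist d i k + d k.
Proof. by move=> le_ik; rewrite /dist big_nat_recr. Qed.

Lemma flatten_iotaS (T : Type) (F : nat -> seq T) (t : nat) :
  flatten [seq F s | s <- iota 0 t.+1] =
  flatten [seq F s | s <- iota 0 t] ++ F t.
Proof. by rewrite -addn1 iotaD map_cat flatten_cat /= cats0. Qed.

Lemma enteredS w c d k t :
  entered w c d k t.+1 = entered w c d k t ++ entering w c d k t.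
Proof. exact: flatten_iotaS. Qed.

(** Conservation at a vertex: those who joined up to time [t] have either left before [t] or stand
    in the queue at [t], whose departures are still to come. *)
Lemma joinedE w c d k t :
  joined w c d k t.+1 = entered w c d k t ++ queue (c k) (joining w c d k) t.
Proof.
elim: t => [|t IHt]; first by rewrite /joined /= cats0.
rewrite /joined flatten_iotaS [flatten _]IHt /entered flatten_iotaS -!catA.
by congr (_ ++ _); rewrite catA cat_take_drop.
Qed.

(** Arrivals at [k.+1] up to time [t] left [k] at least [d k] earlier. The truncated subtraction
    gives the empty list while nobody can have arrived. *)
Lemma perm_joinedS w c d k t :
  perm_eq (joined w c d k.+1 t.+1)
          (residents w k.+1 ++ entered w c d k (t.+1 - d k)).
Proof.
elim: t => [|t IHt].
  rewrite /joined /= cats0 perm_cat2l.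
  case: (d k) => [|e] /=; last by rewrite subSS sub0n.
  by rewrite /entered /= cats0.
rewrite /joined flatten_iotaS (perm_trans (perm_cat IHt (perm_refl _))) //=.
rewrite -catA perm_cat2l; case: leqP => [le_dt|lt_td].
  by rewrite (subSn le_dt) /entered flatten_iotaS.
by rewrite cats0 (eqP lt_td) (eqP (ltnW lt_td)).
Qed.

Lemma entered_prefix w c d k t :
  prefix (entered w c d k t) (joined w c d k t.+1).
Proof. by rewrite joinedE prefix_prefix. Qed.

Lemma mem_people w k i j : ((i, j) \in people w k) = (i <= k) && (j < w i).
Proof.
apply/allpairsPdep/andP => [[a [b]]|[le_ik lt_jw]].
  by rewrite !mem_iota /= !add0n => -[? ? [-> ->]].
by exists i, j; rewrite !mem_iota /= !add0n.
Qed.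

Lemma people_uniq w k : uniq (people w k).
Proof.
apply: allpairs_uniq_dep; rewrite ?iota_uniq //.
  by move=> ? _; apply: iota_uniq.
by case=> ? ? [? ?] _ _ /= [-> ->].
Qed.

Lemma size_people w k : size (people w k) = pop w k.
Proof.
rewrite size_allpairs_dep /pop sumnE big_map /index_iota subn0.
by apply: eq_bigr => i _; rewrite size_iota.
Qed.

(** By induction on the vertex: those who join at [k.+1] are its residents and people leaving [k],
    who started no further than [k]. Nobody is counted twice, so sizes can replace membership. *)
Lemma entered_people w c d k t :
  uniq (entered w c d k t) /\ {subset entered w c d k t <= people w k}.
Proof.
suff: uniq (joined w c d k t.+1) /\ {subset joined w c d k t.+1 <= people w k}.
  have /prefixP[q ->] := entered_prefix w c d k t.
  rewrite cat_uniq => -[/and3P[? _ _] sub]; split=> // p p_in.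
  by apply: sub; rewrite mem_cat p_in.
elim: k t => [|k IHk] t.
  suff -> : joined w c d 0 t.+1 = residents w 0.
    split=> [|[i j]]; first by rewrite map_inj_uniq ?iota_uniq // => ? ? [].
    by case/mapP=> b; rewrite mem_iota /= add0n => lt_bw [-> ->]; rewrite mem_people.
  elim: t => [|t IHt]; first by rewrite /joined /= !cats0.
  by rewrite /joined flatten_iotaS [flatten _]IHt /= cats0.
have pJ := perm_joinedS w c d k t.
have [uE sE] : uniq (entered w c d k (t.+1 - d k)) /\
    {subset entered w c d k (t.+1 - d k) <= people w k}.
  have [uJ sJ] := IHk (t.+1 - d k).
  have /prefixP[q eJ] := entered_prefix w c d k (t.+1 - d k).
  move: uJ sJ; rewrite eJ cat_uniq => /and3P[? _ _] sub; split=> // p p_in.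
  by apply: sub; rewrite mem_cat p_in.
split.
  rewrite (perm_uniq pJ) cat_uniq uE andbT map_inj_uniq ?iota_uniq; last by move=> ? ? [].
  apply/hasPn=> -[i j] /sE; rewrite mem_people => /andP[le_ik _].
  by apply/mapP=> -[b _ [ei _]]; rewrite ei ltnn in le_ik.
move=> [i j]; rewrite (perm_mem pJ) mem_cat mem_people => /orP[/mapP[b]|/sE].
  by rewrite mem_iota /= add0n => lt_bw [-> ->]; rewrite leqnn.
by rewrite mem_people => /andP[/leqW-> ->].
Qed.

Lemma size_entered0 w c d t :
  size (entered w c d 0 t.+1) = minn (size (entered w c d 0 t) + c 0) (w 0).
Proof.
have sJ : size (joined w c d 0 t.+1) = w 0.
  elim: t => [|t IHt]; first by rewrite /joined /= !cats0 size_map size_iota.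
  by rewrite /joined flatten_iotaS size_cat [size _]IHt /= addn0.
move: sJ; rewrite joinedE enteredS !size_cat size_take_min.
move: (size (queue _ _ _)) (size _) => q e. lia.
Qed.

(** Departures grow by [c k.+1] unless the queue is exhausted, in which case everyone who has joined
    has left. This recurrence is all that the counting below uses of the queue dynamics. *)
Lemma size_enteredS w c d k t :
  size (entered w c d k.+1 t.+1) =
  minn (size (entered w c d k.+1 t) + c k.+1)
       (w k.+1 + size (entered w c d k (t.+1 - d k))).
Proof.
have := perm_size (perm_joinedS w c d k t); move: (entered w c d k _) => E.
rewrite joinedE enteredS !size_cat size_map size_iota size_take_min.
move: (size (queue _ _ _)) (size E) (size (entered _ _ _ _ _)) => q e1 e.
move: (w k.+1) (c k.+1) => w1 c1; lia.
Qed.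

(* The slack [r] makes the statement strong enough for the induction on [t]. *)
Lemma pop_le_entered w c d k t r :
  pop w k <= size (entered w c d k t) + r <->
  (forall i l, i <= l <= k -> pop w i <= c l * (t - dist d i k) + r).
Proof.
have at0 (Q : nat -> nat -> Prop) : (forall i l, i <= l <= 0 -> Q i l) <-> Q 0 0.
  split=> [|Q00 i l /andP[le_il]]; first exact.
  by rewrite leqn0 => /eqP l0; move: le_il; rewrite l0 leqn0 => /eqP->.
elim: k t r => [|k IHk].
  elim=> [|t IHt] r; first by rewrite at0 muln0.
  have -> : pop w 0 <= size (entered w c d 0 t.+1) + r <->
            pop w 0 <= size (entered w c d 0 t) + (c 0 + r).
    by rewrite size_entered0 /pop big_nat1; lia.
  by rewrite IHt !at0 /dist big_geq // !subn0 mulnS; lia.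
elim=> [|t IHt] r.
  split=> [le_r i l /andP[le_il le_lk]|].
    rewrite muln0; apply: leq_trans le_r; apply: leq_pop; lia.
  by move/(_ k.+1 k.+1); rewrite leqnn => /(_ isT); rewrite muln0.
(* The minimum in the recurrence splits into two inequalities: the same claim at time [t] with one
   batch added to the slack, and the claim at vertex [k], where the residents of [k.+1] cancel. *)
have -> : pop w k.+1 <= size (entered w c d k.+1 t.+1) + r <->
    pop w k.+1 <= size (entered w c d k.+1 t) + (c k.+1 + r) /\
    pop w k <= size (entered w c d k (t.+1 - d k)) + r.
  by rewrite size_enteredS popS; lia.
rewrite IHt IHk; split=> [[H1 H2] i l /andP[le_il]|H].
  have [lt_lk _|lt_kl le_lk] := leqP l k.
    have := H2 i l; rewrite le_il lt_lk distS ?(leq_trans le_il) // => /(_ isT).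
    by rewrite [dist _ _ _ + _]addnC subnDA.
  have -> : l = k.+1 by lia.
  have [-> |lt_ik] := eqVneq i k.+1.
    have := H1 k.+1 k.+1; rewrite leqnn => /(_ isT).
    by rewrite /dist big_geq // !subn0 mulnS; lia.
  have le_ik : i <= k by lia.
  have := H2 i k; have := H1 i k.+1; rewrite le_ik !leqnn leqW // => /(_ isT).
  move=> + /(_ isT); rewrite distS //; move: (dist d i k) => D.
  case: (leqP (D + d k) t) => [le_Dt|lt_tD].
    by rewrite (subSn le_Dt) mulnS; lia.
  (* Nobody from [i] can have reached [k.+1] yet, so the bound for edge [k] already reads
     [pop w i <= r]. *)
  have -> : t.+1 - d k - D = 0 by lia.
  lia.
split=> [i l /andP[le_il le_lk]|i l /andP[le_il le_lk]].
  have := H i l; rewrite le_il le_lk => /(_ isT).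
  have := H i k.+1; rewrite (leq_trans le_il le_lk) leqnn => /(_ isT).
  move: (dist d i k.+1) => D.
  case: (leqP D t) => [le_Dt|lt_tD]; last first.
    have -> : t.+1 - D = 0 by lia.
    lia.
  rewrite (subSn le_Dt) !mulnS; move: (t - D) => u.
  (* One time step is traded for one batch of size [c k.+1]; the bound to use is that of whichever
     of the edges [l] and [k.+1] has the smaller capacity. *)
  case: (leqP (c l) (c k.+1)) => [|/ltnW] le_c; first by lia.
  by have := leq_mul2r u (c k.+1) (c l); rewrite le_c orbT; lia.
have := H i l; rewrite le_il leqW // => /(_ isT).
by rewrite distS ?(leq_trans le_il) // [dist _ _ _ + _]addnC subnDA.
Qed.

(** Without duplicates, everyone has entered as soon as the count reaches [pop w k]. The counting
    bound with slack 0 is then solved for [t], its ceiling being written as a quotient of the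
    predecessor. *)
Lemma all_entered w c d k t :
  (forall l, l <= k -> 0 < c l) ->
  {subset people w k <= entered w c d k t.+1} <->
  (forall i l, i <= l <= k -> 0 < pop w i ->
     (pop w i).-1 %/ c l + dist d i k <= t).
Proof.
move=> c_gt0; have [uE sE] := entered_people w c d k t.+1.
have -> : {subset people w k <= entered w c d k t.+1} <->
    pop w k <= size (entered w c d k t.+1) + 0.
  rewrite addn0 -size_people; split=> [|le_s]; first exact/uniq_leq_size/people_uniq.
  by have [_ eqE] := uniq_min_size uE sE le_s => p; rewrite eqE.
rewrite pop_le_entered; split=> H i l le_ilk.
  move=> pop_gt0; have := H i l le_ilk; rewrite addn0 => le_p.
  have : (pop w i).-1 %/ c l < t.+1 - dist d i k.
    by rewrite ltn_divLR ?c_gt0 ?(andP le_ilk).2 //; lia.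
  lia.
have [-> //|pop_gt0] := posnP (pop w i).
have := H i l le_ilk pop_gt0 => le_t; rewrite addn0.
have : (pop w i).-1 %/ c l < t.+1 - dist d i k by lia.
by rewrite ltn_divLR ?c_gt0 ?(andP le_ilk).2 //; lia.
Qed.

Local Open Scope ring_scope.

(** * Evacuation times *)

Lemma vpos_lt (R : realType) (P : dynpath R) (i j : nat) :
  (i <= nedges P)%N -> (j <= nedges P)%N -> (vpos P i < vpos P j) = (i < j)%N.
Proof.
move=> le_in le_jn; apply: (lt_sorted_ltn_nth 0 (pos_sorted P));
by rewrite inE size_tuple.
Qed.

Lemma vpos_le (R : realType) (P : dynpath R) (i j : nat) :
  (i <= nedges P)%N -> (j <= nedges P)%N -> (vpos P i <= vpos P j) = (i <= j)%N.
Proof. by move=> le_in le_jn; rewrite leNgt vpos_lt // -leqNgt. Qed.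

Lemma capacity_gt0 (R : realType) (P : dynpath R) (l : nat) :
  (l < nedges P)%N -> (0 < capacity P l)%N.
Proof. by move=> lt_ln; apply: (all_nthP 0%N (cap_gt0 P)); rewrite size_tuple. Qed.

Lemma travelE (R : realType) (P : dynpath R) (i : nat) :
  (i < nedges P)%N -> (travel P i)%:R = (vpos P i.+1 - vpos P i) * tau P.
Proof.
move=> lt_in; have gap_gt0 : 0 < vpos P i.+1 - vpos P i.
  by rewrite subr_gt0 vpos_lt // ltnW.
apply: truncnK; rewrite natrEint mulr_ge0 ?(ltW gap_gt0) ?(ltW (tau_gt0 P)) // andbT.
have := travel_int (@Ordinal (nedges P).+1 i.+1 lt_in) (@Ordinal (nedges P).+1 i (ltnW lt_in)).
by rewrite !(tnth_nth 0) gtr0_norm.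
Qed.

Lemma distE (R : realType) (P : dynpath R) (i k : nat) :
  (i <= k <= nedges P)%N ->
  (dist (travel P) i k)%:R = (vpos P k - vpos P i) * tau P.
Proof.
case/andP=> /subnKC <-; elim: (k - i)%N => [|m IHm] le_n.
  by rewrite addn0 subrr mul0r /dist big_geq.
rewrite addnS in le_n *; rewrite distS ?leq_addr // natrD travelE // IHm 1?ltnW //.
by rewrite -mulrDl; congr (_ * _); lra.
Qed.

Lemma locate_edge (R : realType) (P : dynpath R) (x : R) (l : nat) :
  (l <= nedges P)%N -> vpos P l < x <= vpos P (nedges P) ->
  exists k, (l <= k < nedges P)%N /\ vpos P k < x <= vpos P k.+1.
Proof.
move=> le_ln /andP[lt_lx le_xn].
have ex : exists m, x <= vpos P m by exists (nedges P).
case: (ex_minnP ex) => -[|k] le_xk min_k.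
  by have := lt_le_trans lt_lx le_xk; rewrite vpos_lt // ltn0.
exists k; split; last by rewrite le_xk ltNge andbT; apply/negP=> /min_k; rewrite ltnn.
rewrite (min_k _ le_xn) andbT -ltnS -(@vpos_lt _ P) // ?(min_k _ le_xn) //.
exact: lt_le_trans le_xk.
Qed.

Lemma edge_unique (R : realType) (P : dynpath R) (x : R) (k k' : nat) :
  (k < nedges P)%N -> (k' < nedges P)%N ->
  vpos P k < x <= vpos P k.+1 -> vpos P k' < x <= vpos P k'.+1 -> k = k'.
Proof.
have half a b : (a < nedges P)%N -> (b < nedges P)%N ->
    vpos P a < x -> x <= vpos P b.+1 -> (a <= b)%N.
  move=> lt_a lt_b lt_ax le_xb; rewrite -ltnS -(@vpos_lt _ P) //.
    exact: lt_le_trans le_xb.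
  exact: ltnW.
move=> lt_k lt_k' /andP[kx xk] /andP[k'x xk']; apply/eqP.
by rewrite eqn_leq (half _ _ lt_k lt_k' kx xk') (half _ _ lt_k' lt_k k'x xk).
Qed.

(* [_.-1 %/ c] is [ceil(_ / c) - 1] for a positive number of people. *)
Definition arrival (R : realType) (P : dynpath R) (x : R) (i l : nat) : R :=
  (x - vpos P i) * tau P + ((pop (weight P) i).-1 %/ capacity P l)%:R.

Lemma mem_entered w c d k t (p : person) :
  reflect (exists2 s, (s < t)%N & p \in entering w c d k s)
          (p \in entered w c d k t).
Proof.
apply: (iffP flatten_mapP) => -[s]; rewrite ?mem_iota /=; exists s => //.
by rewrite mem_iota.
Qed.

(** If [x] lies on the edge from [k] to [k.+1] and the last leg takes [delta], evacuation by [T]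
    means that everyone up to [k] enters that edge no later than the floor of [T - delta]. Then
    [all_entered] applies, and [dist] plus [delta] telescopes to the travel time from [i] to [x]. *)
Lemma evacuatedLP (R : realType) (P : dynpath R) (x T : R) :
  x <= vpos P (nedges P) ->
  evacuatedL P x T <->
  (forall i l, (i <= l < nedges P)%N -> vpos P l < x ->
     (0 < pop (weight P) i)%N -> arrival P x i l <= T).
Proof.
move=> le_xn; have tau_ge0 := ltW (tau_gt0 P).
have cap_gt0 k : (k < nedges P)%N ->
    forall l, (l <= k)%N -> (0 < capacity P l)%N.
  by move=> lt_kn l le_lk; apply/capacity_gt0/(leq_ltn_trans le_lk).
split=> [evac i l /andP[le_il lt_ln] lt_lx pop_gt0 | arr i j lt_in lt_ix lt_jw].
  have [||k [/andP[le_lk lt_kn] kx]] := @locate_edge _ P x l; rewrite ?(ltnW lt_ln) ?lt_lx //.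
  pose delta := (x - vpos P k) * tau P.
  have evac' i' j' : (i' <= k)%N -> (j' < weight P i')%N ->
      exists2 t, (i', j') \in entering_right P k t & t%:R + delta <= T.
    move=> le_ik lt_jw.
    have [||//|k' [t [lt_kn' kx' ? ?]]] := evac i' j'.
    - exact: leq_ltn_trans le_ik (leqW lt_kn).
    - apply: le_lt_trans (andP kx).1.
      by rewrite (vpos_le (ltnW (leq_ltn_trans le_ik lt_kn)) (ltnW lt_kn)).
    by exists t; rewrite // /delta (edge_unique lt_kn lt_kn' kx kx').
  (* A positive [pop] supplies an actual traveller, so [T - delta] is nonnegative and its truncation
     is a floor. *)
  have le_dT : delta <= T.
    have /hasP[[i' j']] : has predT (people (weight P) i) by rewrite has_predT size_people.
    rewrite mem_people => /andP[le_i'i lt_jw] _.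
    have [||t _] := evac' i' j' => //; first by rewrite (leq_trans le_i'i) ?(leq_trans le_il).
    by apply: le_trans; rewrite lerDr.
  pose t0 := Num.truncn (T - delta).
  have : {subset people (weight P) k <=
          entered (weight P) (capacity P) (travel P) k t0.+1}.
    move=> [i' j']; rewrite mem_people => /andP[le_ik lt_jw].
    have [t t_in le_tT] := evac' _ _ le_ik lt_jw; apply/mem_entered; exists t => //.
    by rewrite ltnS truncn_ge_nat ?subr_ge0 // lerBrDr.
  move/(all_entered _ _ _ (cap_gt0 _ lt_kn))/(_ i l); rewrite le_il le_lk => /(_ isT pop_gt0).
  rewrite truncn_ge_nat ?subr_ge0 // natrD distE ?(leq_trans le_il) //; last exact: ltnW.
  by rewrite /arrival /delta; lra.
have [||k [/andP[le_ik lt_kn] kx]] := @locate_edge _ P x i => //.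
  by rewrite lt_ix le_xn.
have pop_i : (0 < pop (weight P) i)%N.
  by rewrite /pop big_nat_recr //= addn_gt0 (leq_ltn_trans _ lt_jw) ?orbT.
pose delta := (x - vpos P k) * tau P.
have arr' i' l : (i' <= l <= k)%N -> (0 < pop (weight P) i')%N ->
    ((pop (weight P) i').-1 %/ capacity P l + dist (travel P) i' k)%:R + delta <= T.
  move=> /andP[le_il le_lk] pop_gt0; have := arr i' l; rewrite le_il (leq_ltn_trans le_lk) //.
  rewrite natrD distE ?(leq_trans le_il) //; last exact: ltnW.
  rewrite /arrival /delta => /(_ isT _ pop_gt0) H.
  suff /H : vpos P l < x by lra.
  apply: le_lt_trans (andP kx).1.
  by rewrite (vpos_le (ltnW (leq_ltn_trans le_lk lt_kn)) (ltnW lt_kn)).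
have le_dT : delta <= T.
  have := arr' i i; rewrite leqnn le_ik => /(_ isT pop_i).
  by apply: le_trans; rewrite lerDr.
pose t0 := Num.truncn (T - delta).
have /(all_entered _ _ _ (cap_gt0 _ lt_kn)) sub : forall i' l, (i' <= l <= k)%N ->
    (0 < pop (weight P) i')%N ->
    ((pop (weight P) i').-1 %/ capacity P l + dist (travel P) i' k <= t0)%N.
  move=> i' l le_ilk pop_gt0.
  by rewrite truncn_ge_nat ?subr_ge0 // lerBrDr; apply: arr'.
have /mem_entered[t lt_t t_in] : (i, j) \in
    entered (weight P) (capacity P) (travel P) k t0.+1.
  by apply: sub; rewrite mem_people le_ik.
exists k, t; split=> //.
by rewrite -lerBrDr -truncn_ge_nat ?subr_ge0.
Qed.

(** Every condition on an admissible time is a lower bound, so the infimum is itself admissible.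
    Describing [ThetaL] by its upper bounds avoids maxima over index sets that vary with [x]. *)
Lemma ThetaL_le (R : realType) (P : dynpath R) (x T : R) :
  x <= vpos P (nedges P) ->
  ThetaL P x <= T <->
  0 <= T /\
  (forall i l, (i <= l < nedges P)%N -> vpos P l < x ->
     (0 < pop (weight P) i)%N -> arrival P x i l <= T).
Proof.
move=> le_xn; set S : set R := [set T' | 0 <= T' /\ evacuatedL P x T']%classic.
have lbS : has_lbound S by exists 0 => ? [].
have S0 : (S !=set0)%classic.
  (* The maximum over all pairs, constraining or not, is an admissible time. *)
  pose F (p : 'I_(nedges P) * 'I_(nedges P)) := arrival P x p.1 p.2.
  exists (\big[Num.max/0]_p F p); split.
    exact: bigmax_ge_id.
  apply/(evacuatedLP _ le_xn) => i l /andP[le_il lt_ln] _ _.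
  exact: (le_bigmax _ F (Ordinal (leq_ltn_trans le_il lt_ln), Ordinal lt_ln)).
have S_inf : S (inf S).
  split; first by apply: lb_le_inf => // ? [].
  apply/(evacuatedLP _ le_xn) => i l le_il lt_lx pop_gt0; apply: lb_le_inf => //.
  by move=> T' [_ /(evacuatedLP _ le_xn)]; apply.
split=> [le_T|[T_ge0 /(evacuatedLP _ le_xn) evT]]; last exact: ge_inf.
case: S_inf => inf_ge0 /(evacuatedLP _ le_xn) arr; split; first exact: le_trans le_T.
by move=> i l ? ? ?; apply: le_trans (arr _ _ _ _ _) le_T.
Qed.

Lemma eq_upper_bounds (R : realType) (a b : R) :
  (forall T, a <= T <-> b <= T) -> a = b.
Proof. by move=> ab; apply/le_anti/andP; split; apply/ab. Qed.

Lemma ThetaL_ge0 (R : realType) (P : dynpath R) (x : R) :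
  x <= vpos P (nedges P) -> 0 <= ThetaL P x.
Proof. by move=> le_xn; have [] := (ThetaL_le (ThetaL P x) le_xn).1 (lexx _). Qed.

Lemma ThetaL_first (R : realType) (P : dynpath R) : ThetaL P (vpos P 0) = 0.
Proof.
have le_0n : vpos P 0 <= vpos P (nedges P) by rewrite vpos_le.
apply/le_anti; rewrite ThetaL_ge0 // andbT; apply/ThetaL_le => //; split=> // i l.
by move=> /andP[_ lt_ln]; rewrite vpos_lt // ltnW.
Qed.

Lemma le_ThetaL (R : realType) (P : dynpath R) (x y : R) :
  x <= y -> y <= vpos P (nedges P) -> ThetaL P x <= ThetaL P y.
Proof.
move=> le_xy le_yn; apply/ThetaL_le; first exact: le_trans le_yn.
have [Ty_ge0 arr] := (ThetaL_le (ThetaL P y) le_yn).1 (lexx _).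
split=> // i l le_il lt_lx pop_gt0.
apply: le_trans (arr i l le_il (lt_le_trans lt_lx le_xy) pop_gt0).
by rewrite lerD2r ler_wpM2r ?(ltW (tau_gt0 P)) // lerB.
Qed.

(** For all [x] in the half-open edge the same indices [l <= k] are active, so moving [x] shifts
    every arrival term by the same amount; only the bound 0 stays put. *)
Lemma ThetaL_edge (R : realType) (P : dynpath R) (k : nat) (x : R) :
  (k < nedges P)%N -> vpos P k < x <= vpos P k.+1 ->
  ThetaL P x =
  Num.max 0 (ThetaL P (vpos P k.+1) - (vpos P k.+1 - x) * tau P).
Proof.
move=> lt_kn kx; have /andP[lt_kx le_xk] := kx.
have le_kn : vpos P k.+1 <= vpos P (nedges P) by rewrite vpos_le.
have gap_ge0 : 0 <= (vpos P k.+1 - x) * tau P.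
  by rewrite mulr_ge0 ?subr_ge0 // ltW ?tau_gt0.
apply: eq_upper_bounds => T; rewrite ge_max lerBlDr.
split=> [/(ThetaL_le _ (le_trans le_xk le_kn))[T_ge0 arr]|].
  rewrite T_ge0; apply/ThetaL_le => //; split; first exact: addr_ge0.
  move=> i l /andP[le_il lt_ln]; rewrite (vpos_lt (ltnW lt_ln) lt_kn) ltnS => le_lk pop_gt0.
  have := arr i l; rewrite le_il lt_ln => /(_ isT _ pop_gt0).
  have -> : vpos P l < x.
    by apply: le_lt_trans lt_kx; rewrite (vpos_le (ltnW lt_ln) (ltnW lt_kn)).
  by move=> /(_ isT); rewrite /arrival; lra.
move=> /andP[T_ge0 /(ThetaL_le _ le_kn)[_ arr]].
apply/ThetaL_le; first exact: le_trans le_kn.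
split=> // i l le_il lt_lx pop_gt0.
have := arr i l le_il (lt_le_trans lt_lx le_xk) pop_gt0.
by rewrite /arrival; lra.
Qed.

(** * Reflection of the path *)

Lemma tnth_rev_opp (R : zmodType) (n : nat) (s : n.-tuple R) (i : 'I_n) :
  tnth [tuple of rev [tuple of [seq - x | x <- s]]] i = - tnth s (rev_ord i).
Proof.
rewrite !(tnth_nth 0) /= nth_rev ?size_map size_tuple ?ltn_ord //.
by rewrite (nth_map 0) // size_tuple; apply: rev_ord_proof.
Qed.

Lemma mirror_pos_sorted (R : realType) (P : dynpath R) :
  sorted <%R [tuple of rev [tuple of [seq - x | x <- pos P]]].
Proof.
rewrite /= rev_sorted sorted_map.
by have := pos_sorted P; apply: sub_sorted => x y /=; rewrite ltrN2.
Qed.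

Lemma mirror_cap_gt0 (R : realType) (P : dynpath R) :
  all (leq 1) [tuple of rev (cap P)].
Proof. by rewrite /= all_rev cap_gt0. Qed.

Lemma mirror_travel_int (R : realType) (P : dynpath R) (i j : 'I_(nedges P).+1) :
  `|tnth [tuple of rev [tuple of [seq - x | x <- pos P]]] i
   - tnth [tuple of rev [tuple of [seq - x | x <- pos P]]] j| * tau P
  \is a Num.int.
Proof. by rewrite !tnth_rev_opp -opprD normrN; apply: travel_int. Qed.

(** Negating the positions makes them increasing again after reversal and keeps all distances, so
    facts on [ThetaL] transfer to [ThetaR]. *)
Definition mirror (R : realType) (P : dynpath R) : dynpath R :=
  DynPath [tuple of rev (wgt P)] (mirror_pos_sorted P) (mirror_cap_gt0 P)
    (tau_gt0 P) (@mirror_travel_int R P).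

Lemma vpos_mirror (R : realType) (P : dynpath R) (i : nat) :
  (i <= nedges P)%N -> vpos (mirror P) i = - vpos P (nedges P - i).
Proof.
move=> le_in; rewrite /vpos /= nth_rev ?size_map size_tuple //.
by rewrite (nth_map 0) // size_tuple; lia.
Qed.

Lemma weight_mirror (R : realType) (P : dynpath R) (i : nat) :
  (i <= nedges P)%N -> weight (mirror P) i = weight P (nedges P - i).
Proof. by move=> le_in; rewrite /weight /= nth_rev size_tuple. Qed.

Lemma capacity_mirror (R : realType) (P : dynpath R) (i : nat) :
  (i < nedges P)%N -> capacity (mirror P) i = capacity P (nedges P - i.+1).
Proof. by move=> lt_in; rewrite /capacity /= nth_rev size_tuple. Qed.

Lemma travel_mirror (R : realType) (P : dynpath R) (i : nat) :
  (i < nedges P)%N -> travel (mirror P) i = travel P (nedges P - i.+1).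
Proof.
move=> lt_in; rewrite /travel !vpos_mirror //; last exact: ltnW.
by rewrite subnSK // opprK addrC.
Qed.

Lemma eq_queue c joins joins' t :
  joins =1 joins' -> queue c joins t = queue c joins' t.
Proof. by move=> eqJ; elim: t => [|t /= ->]; rewrite ?eqJ //= eqJ. Qed.

(** Agreement up to [k] is what the reflection provides: beyond the path the mirrored tuples give
    default values, while the truncated indices in [entering_left] stop at 0. *)
Lemma eq_entering w w' c c' d d' k t :
  (forall i, (i <= k)%N -> w i = w' i) -> (forall i, (i <= k)%N -> c i = c' i) ->
  (forall i, (i < k)%N -> d i = d' i) ->
  entering w c d k t = entering w' c' d' k t.
Proof.
move=> eqw eqc eqd.
suff eqJ : forall i, (i <= k)%N -> joining w c d i =1 joining w' c' d' i.
  by rewrite /entering eqc // (eq_queue _ _ (eqJ k (leqnn k))).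
elim=> [|i IHi] lt_ik s /=; first by rewrite eqw.
by rewrite eqw // eqd // eqc ?(eq_queue _ _ (IHi (ltnW lt_ik))) // ltnW.
Qed.

Lemma entering_mirror (R : realType) (P : dynpath R) (k t : nat) :
  (k < nedges P)%N -> entering_right (mirror P) k t = entering_left P k t.
Proof.
move=> lt_kn; apply: eq_entering => i le_ik.
- by rewrite weight_mirror // (leq_trans le_ik) // ltnW.
- by rewrite capacity_mirror // (leq_ltn_trans le_ik).
- by rewrite travel_mirror // (ltn_trans le_ik).
Qed.

Lemma evacuatedR_mirror (R : realType) (P : dynpath R) (x T : R) :
  evacuatedR P x T <-> evacuatedL (mirror P) (- x) T.
Proof.
have edge k : (k < nedges P)%N ->
    (vpos (mirror P) k < - x <= vpos (mirror P) k.+1) =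
    (vpos P (nedges P - k.+1) <= x < vpos P (nedges P - k.+1).+1).
  move=> lt_kn; rewrite (vpos_mirror (ltnW lt_kn)) (vpos_mirror lt_kn).
  by rewrite ltrN2 lerN2 subnSK // andbC.
split=> evac i j le_in.
  rewrite ltnS in le_in.
  rewrite vpos_mirror // ltrN2 weight_mirror // => lt_xi lt_jw.
  have [||//|k [t [lt_kn kx t_in le_tT]]] := evac (nedges P - i)%N j.
  - by rewrite ltnS leq_subr.
  - by [].
  rewrite subKn // in t_in.
  have lt_kn' : (nedges P - k.+1 < nedges P)%N by lia.
  exists (nedges P - k.+1)%N, t; rewrite edge // entering_mirror //.
  rewrite vpos_mirror; last exact: ltnW.
  have -> : (nedges P - (nedges P - k.+1).+1 = k)%N by lia.
  have -> : (nedges P - (nedges P - k.+1) = k.+1)%N by lia.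
  by split=> //; rewrite opprK [- x + _]addrC.
rewrite ltnS in le_in => lt_xi lt_jw.
have [||//|k [t [lt_kn kx t_in le_tT]]] := evac (nedges P - i)%N j.
- by rewrite ltnS leq_subr.
- by rewrite vpos_mirror ?leq_subr // subKn // ltrN2.
- by rewrite weight_mirror ?leq_subr // subKn.
have lt_kn' : (nedges P - k.+1 < nedges P)%N by rewrite /= in lt_kn; lia.
exists (nedges P - k.+1)%N, t; rewrite -edge // -entering_mirror //; last first.
  by rewrite /= in lt_kn; lia.
have -> : (nedges P - (nedges P - k.+1).+1 = k)%N by rewrite /= in lt_kn; lia.
split=> //; move: le_tT; rewrite vpos_mirror; last exact: ltnW.
by rewrite subnSK // opprK [- x + _]addrC.
Qed.

Lemma ThetaR_mirror (R : realType) (P : dynpath R) (x : R) :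
  ThetaR P x = ThetaL (mirror P) (- x).
Proof.
congr inf; apply/seteqP; split=> T [T_ge0 evac]; split=> //;
exact/evacuatedR_mirror.
Qed.

Lemma ThetaR_ge0 (R : realType) (P : dynpath R) (x : R) :
  vpos P 0 <= x -> 0 <= ThetaR P x.
Proof.
move=> le_0x; rewrite ThetaR_mirror; apply: ThetaL_ge0.
by rewrite vpos_mirror // subnn lerN2.
Qed.

Lemma ThetaR_last (R : realType) (P : dynpath R) :
  ThetaR P (vpos P (nedges P)) = 0.
Proof.
rewrite ThetaR_mirror; have := ThetaL_first (mirror P).
by rewrite vpos_mirror // subn0.
Qed.

Lemma ge_ThetaR (R : realType) (P : dynpath R) (x y : R) :
  vpos P 0 <= x -> x <= y -> ThetaR P y <= ThetaR P x.
Proof.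
move=> le_0x le_xy; rewrite !ThetaR_mirror; apply: le_ThetaL; first by rewrite lerN2.
by rewrite vpos_mirror // subnn lerN2.
Qed.

Lemma ThetaR_edge (R : realType) (P : dynpath R) (k : nat) (x : R) :
  (k < nedges P)%N -> vpos P k <= x < vpos P k.+1 ->
  ThetaR P x = Num.max 0 (ThetaR P (vpos P k) - (x - vpos P k) * tau P).
Proof.
move=> lt_kn kx; have lt_kn' : (nedges P - k.+1 < nedges P)%N by lia.
have ek : (nedges P - (nedges P - k.+1).+1 = k)%N by lia.
have ek1 : (nedges P - (nedges P - k.+1) = k.+1)%N by lia.
rewrite !ThetaR_mirror (@ThetaL_edge _ (mirror P) (nedges P - k.+1)) //.
  by rewrite vpos_mirror // ek opprK [- _ + x]addrC.
by rewrite (vpos_mirror (ltnW lt_kn')) (vpos_mirror lt_kn') ek ek1 ltrN2 lerN2 andbC.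
Qed.

(** * The optimum on the crossing edge *)

Lemma Theta1_eq (R : realType) (P : dynpath R) (y : R) :
  vpos P 0 <= y <= vpos P (nedges P) ->
  (forall x, vpos P 0 <= x <= vpos P (nedges P) -> Theta P y <= Theta P x) ->
  Theta1 P = Theta P y.
Proof.
move=> y_in min_y; apply/le_anti/andP; split.
  by apply: ge_inf; [exists (Theta P y) => _ [x x_in <-]; apply: min_y|exists y].
by apply: lb_le_inf; [exists (Theta P y), y|move=> _ [x x_in <-]; apply: min_y].
Qed.

(* The truncation at 0 covers the case where nobody starts on one side of the
   edge, so that the affine formulas are not the actual times. *)
Definition edge_opt (R : realType) (a b t A B : R) : R * R :=
  let D := (b - a) * t in
  if B + D <= A then (B, a)
  else if A + D <= B then (A, b)
  else (Num.max 0 ((A + B - D) / 2), ((B - A) / t + a + b) / 2).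

(** The comparisons at [lo] and [hi] let monotonicity dispose of sinks outside the edge; on the edge
    both times are truncated affine functions. The case [lo = hi] arises for a single vertex: then
    the edge has length 0 and the first branch of [edge_opt] applies. *)
Lemma edge_optP (R : realType) (P : dynpath R) (lo hi : nat) :
  (lo <= hi <= lo.+1)%N -> (hi <= nedges P)%N ->
  ThetaL P (vpos P lo) <= ThetaR P (vpos P lo) ->
  ThetaR P (vpos P hi) <= ThetaL P (vpos P hi) ->
  let o := edge_opt (vpos P lo) (vpos P hi) (tau P)
             (ThetaL P (vpos P hi)) (ThetaR P (vpos P lo)) in
  [/\ vpos P 0 <= o.2 <= vpos P (nedges P), Theta P o.2 = o.1 & Theta1 P = o.1].
Proof.
move=> /andP[le_lohi le_hilo] le_hin LR_lo RL_hi o.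
have le_lon := leq_trans le_lohi le_hin.
suff [y_in Ty min_y] : [/\ vpos P 0 <= o.2 <= vpos P (nedges P), Theta P o.2 = o.1 &
    forall x, vpos P 0 <= x <= vpos P (nedges P) -> Theta P o.2 <= Theta P x].
  by split=> //; rewrite -Ty; apply: Theta1_eq.
have tau_gt0 := tau_gt0 P.
have lo_in : vpos P 0 <= vpos P lo <= vpos P (nedges P) by rewrite !vpos_le.
have hi_in : vpos P 0 <= vpos P hi <= vpos P (nedges P) by rewrite !vpos_le.
have le_ab : vpos P lo <= vpos P hi by rewrite vpos_le.
have eq_hi : vpos P lo < vpos P hi -> hi = lo.+1.
  by rewrite vpos_lt // => ?; lia.
rewrite /o /edge_opt; set a := vpos P lo; set b := vpos P hi.
rewrite -/a -/b in LR_lo RL_hi lo_in hi_in le_ab eq_hi.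
set A := ThetaL P b; set B := ThetaR P a; set D := (b - a) * tau P.
have D_ge0 : 0 <= D by rewrite mulr_ge0 ?subr_ge0 // ltW.
have Ledge x : a < x <= b -> ThetaL P x = Num.max 0 (A - (b - x) * tau P).
  move=> /andP[lt_ax le_xb]; move: (eq_hi (lt_le_trans lt_ax le_xb)) => ehi.
  by rewrite /A /b ehi; apply: ThetaL_edge; rewrite -?ehi //; apply/andP.
have Redge x : a <= x < b -> ThetaR P x = Num.max 0 (B - (x - a) * tau P).
  move=> /andP[le_ax lt_xb]; move: (eq_hi (le_lt_trans le_ax lt_xb)) => ehi.
  by apply: ThetaR_edge; rewrite -?ehi //; apply/andP.
have Lmono x y : x <= y -> vpos P 0 <= x <= vpos P (nedges P) ->
  vpos P 0 <= y <= vpos P (nedges P) -> ThetaL P x <= ThetaL P y.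
  by move=> ? _ /andP[_ ?]; apply: le_ThetaL.
have Rmono x y : x <= y -> vpos P 0 <= x <= vpos P (nedges P) ->
  vpos P 0 <= y <= vpos P (nedges P) -> ThetaR P y <= ThetaR P x.
  by move=> ? /andP[? _] _; apply: ge_ThetaR.
(* [ThetaL] may jump just right of [a]. Here all its values there are at least [B], which is the
   value of [Theta] at [a]. *)
case: ifPn => [le_A|].
  have Ta : Theta P a = B by rewrite /Theta max_r.
  split=> // x x_in; rewrite Ta /Theta le_max.
  have [le_xa|lt_ax] := leP x a; first by rewrite (Rmono x a) ?orbT.
  have [le_xb|lt_bx] := leP x b; last first.
    apply/orP; left; apply: le_trans (Lmono b x (ltW lt_bx) hi_in x_in).
    by rewrite -/A; lra.
  rewrite Ledge ?lt_ax // !le_max; apply/orP; left; apply/orP; right.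
  have : (b - x) * tau P <= D by rewrite ler_pM2r // lerB // ltW.
  lra.
(* Symmetrically, every value of [ThetaR] left of [b] is at least [A]. *)
rewrite -ltNge => lt_A; case: ifPn => [le_B|].
  have Tb : Theta P b = A by rewrite /Theta max_l.
  split=> // x x_in; rewrite Tb /Theta le_max.
  have [le_bx|lt_xb] := leP b x; first by rewrite (Lmono b x).
  have [le_ax|lt_xa] := leP a x; last first.
    apply/orP; right; apply: le_trans (Rmono x a (ltW lt_xa) x_in lo_in).
    by rewrite -/B; lra.
  rewrite Redge ?lt_xb ?le_ax // !le_max; apply/orP; right; apply/orP; right.
  have : (x - a) * tau P <= D by rewrite ler_pM2r // lerB // ltW.
  lra.
(* [y] is the crossing of the two affine functions, and failure of both tests is exactly what places
   it strictly inside the edge. Both times equal [v] there, so monotonicity on either side makes it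
   optimal. *)
rewrite -ltNge => lt_B /=; set y := _ / 2; set v := Num.max _ _.
have yt : y * tau P = (B - A + (a + b) * tau P) / 2.
  by rewrite /y; field; rewrite gt_eqF.
have lt_ay : a < y.
  by rewrite -(ltr_pM2r tau_gt0) yt; move: lt_A; rewrite /D; lra.
have lt_yb : y < b.
  by rewrite -(ltr_pM2r tau_gt0) yt; move: lt_B; rewrite /D; lra.
have y_in : vpos P 0 <= y <= vpos P (nedges P).
  case/andP: lo_in => le_0a _; case/andP: hi_in => _ le_bn.
  by rewrite (le_trans le_0a (ltW lt_ay)) (le_trans (ltW lt_yb) le_bn).
have Ly : ThetaL P y = v.
  rewrite Ledge ?lt_ay ?(ltW lt_yb) // /v; congr (Num.max 0 _).
  by rewrite mulrBl yt /D; lra.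
have Ry : ThetaR P y = v.
  rewrite Redge ?lt_yb ?(ltW lt_ay) // /v; congr (Num.max 0 _).
  by rewrite mulrBl yt /D; lra.
have Ty : Theta P y = v by rewrite /Theta Ly Ry maxxx.
split=> // x x_in; rewrite Ty /Theta le_max.
have [le_xy|/ltW le_yx] := leP x y.
  by rewrite -Ry (Rmono x y) ?orbT.
by rewrite -Ly (Lmono y x).
Qed.

(** * The program *)

(** A total-correctness triple in weakest-precondition form; the postcondition also sees the
    cost. *)
Definition runs (R : realType) (p : cmd) (s : store R)
    (Q : store R -> nat -> Prop) : Prop :=
  exists s' k, exec p s s' k /\ Q s' k.

Lemma runs_weaken (R : realType) (p : cmd) (s : store R)
    (Q Q' : store R -> nat -> Prop) :
  (forall s' k, Q s' k -> Q' s' k) -> runs p s Q -> runs p s Q'.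
Proof. by move=> QQ' [s' [k [E /QQ' H]]]; exists s', k. Qed.

Lemma runs_skip (R : realType) (s : store R) (Q : store R -> nat -> Prop) :
  Q s 1 -> runs Skip s Q.
Proof. by move=> H; exists s, 1; split=> //; constructor. Qed.

Lemma runs_nstore (R : realType) a ei ev (s : store R)
    (Q : store R -> nat -> Prop) :
  Q (Store (upd (nmem s) a (neval s ei) (neval s ev)) (rmem s))
    (ncost ei + ncost ev).+1 ->
  runs (NStore a ei ev) s Q.
Proof. by move=> H; do 2!eexists; split; [apply: exec_nstore|]. Qed.

Lemma runs_rstore (R : realType) a ei ev (s : store R)
    (Q : store R -> nat -> Prop) :
  Q (Store (nmem s) (upd (rmem s) a (neval s ei) (reval s ev)))
    (ncost ei + rcost ev).+1 ->
  runs (RStore a ei ev) s Q.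
Proof. by move=> H; do 2!eexists; split; [apply: exec_rstore|]. Qed.

Lemma runs_seq (R : realType) p q (s : store R) (Q : store R -> nat -> Prop) :
  runs p s (fun s1 k1 => runs q s1 (fun s2 k2 => Q s2 (k1 + k2)%N)) ->
  runs (Seq p q) s Q.
Proof.
move=> [s1 [k1 [E1 [s2 [k2 [E2 H]]]]]]; exists s2, (k1 + k2)%N; split=> //.
exact: exec_seq E2.
Qed.

Lemma runs_if (R : realType) b p q (s : store R) (Q : store R -> nat -> Prop) :
  runs (if beval s b then p else q) s (fun s' k => Q s' (bcost b + k).+1) ->
  runs (If b p q) s Q.
Proof. by move=> [s' [k [E H]]]; exists s', (bcost b + k).+1; split=> //; constructor. Qed.

(** The index of [Inv] is a variant bounding the passes left. At most [m] passes of cost at most [c]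
    go with at most [m.+1] tests of the guard. *)
Lemma runs_while (R : realType) b p c (Inv : nat -> store R -> Prop) m (s : store R) :
  (forall m s, Inv m s -> beval s b ->
     (0 < m)%N /\ runs p s (fun s' k => (k <= c)%N /\ Inv m.-1 s')) ->
  Inv m s ->
  runs (While b p) s (fun s' k =>
    [/\ (k <= m.+1 * (bcost b + c).+1)%N, ~~ beval s' b & exists m', Inv m' s']).
Proof.
move=> body; elim: m s => [|m IHm] s Is; have [bs|bNs] := boolP (beval s b).
- by have [] := body _ _ Is bs.
- exists s, (bcost b).+1; split; first exact: exec_while_done.
  by split=> //; [rewrite mul1n ltnS leq_addr|exists 0%N].
- have [_ [s1 [k1 [E1 [le_k1 I1]]]]] := body _ _ Is bs.
  have [s2 [k2 [E2 [le_k2 bN2 I2]]]] := IHm _ I1.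
  exists s2, (bcost b + k1 + k2).+1; split; first exact: exec_while_loop E1 E2.
  by split=> //; rewrite mulSn -addSn leq_add // ltnS leq_add2l.
- exists s, (bcost b).+1; split; first exact: exec_while_done.
  by split=> //; [rewrite mulSn -addnS; lia|exists m.+1].
Qed.

(* Memory layout. Natural numbers: 0-2 input; 3 and 4 hold the prefix sums of
   the weights (cell [i.+1] sums vertices 0 to [i]), and 2 and 5 the capacities, of the path and of its mirror
   image; 6 loop counter; 7 and 8 ends of the search interval; 9 its middle;
   10 running minimum of the capacities; 11 vertex being evaluated. Reals: 0, 1
   input; 2 output; 1 and 3 positions on the path and on its mirror image; 4
   and 5 values of ThetaL and ThetaR; 6 scratch. *)
Definition nvar (a : nat) : nexpr := NLoad a (NConst 0).
Definition rvar (a : nat) : rexpr := RLoad a (NConst 0).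
Definition nset (a : nat) (e : nexpr) : cmd := NStore a (NConst 0) e.
Definition rset (a : nat) (e : rexpr) : cmd := RStore a (NConst 0) e.

(* A boolean selects the given path ([true]) or the reversed one. *)
Definition side (R : realType) (P : dynpath R) (b : bool) : dynpath R :=
  if b then P else mirror P.
Definition aPop (b : bool) : nat := if b then 3 else 4.
Definition aCap (b : bool) : nat := if b then 2 else 5.
Definition aPos (b : bool) : nat := if b then 1 else 3.
Definition aAcc (b : bool) : nat := if b then 4 else 5.

Definition ready (R : realType) (P : dynpath R) (s : store R) : Prop :=
  [/\ nmem s 0 0 = nedges P, rmem s 0 0 = tau P &
   forall b, [/\
     forall i, (i <= nedges P)%N -> nmem s (aPop b) i.+1 = pop (weight (side P b)) i,
     forall i, (i < nedges P)%N -> nmem s (aCap b) i = capacity (side P b) i &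
     forall i, (i <= nedges P)%N -> rmem s (aPos b) i = vpos (side P b) i]].

(** * Evaluating [ThetaL] at a vertex by one sweep *)

(** Descending from the vertex in cell 11 keeps cell 10 equal to the smallest capacity on the way,
    so one term per starting vertex suffices. For vertex 0 the truncated index loads an irrelevant
    capacity, but the loop then makes no pass. *)
Definition scan (b : bool) : cmd :=
  Seq (nset 6 (nvar 11))
  (Seq (rset (aAcc b) (ROfNat (NConst 0)))
  (Seq (nset 10 (NLoad (aCap b) (NSub (nvar 11) (NConst 1))))
  (While (NLe (NConst 1) (nvar 6))
    (Seq (nset 6 (NSub (nvar 6) (NConst 1)))
    (Seq (If (NLe (NLoad (aCap b) (nvar 6)) (nvar 10))
             (nset 10 (NLoad (aCap b) (nvar 6))) Skip)
    (If (NLe (NConst 1) (NLoad (aPop b) (NAdd (nvar 6) (NConst 1))))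
        (Seq (rset 6
               (RAdd (RMul (RSub (RLoad (aPos b) (nvar 11))
                                 (RLoad (aPos b) (nvar 6)))
                           (rvar 0))
                     (ROfNat (NDiv (NSub (NLoad (aPop b) (NAdd (nvar 6) (NConst 1)))
                                         (NConst 1))
                                   (nvar 10)))))
             (If (RLe (rvar (aAcc b)) (rvar 6))
                 (rset (aAcc b) (rvar 6)) Skip))
        Skip)))))).

Definition bottleneck (R : realType) (P : dynpath R) (m i c : nat) : Prop :=
  (forall l, (i <= l < m)%N -> (c <= capacity P l)%N) /\
  (exists l, (i <= l < m)%N /\ c = capacity P l).

(* [acc] is the maximum of 0 and of the terms with first index at least [i]. *)
Definition scanned (R : realType) (P : dynpath R) (m i : nat) (acc : R) : Prop :=
  forall T, acc <= T <->
  0 <= T /\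
  (forall i' l, (i <= i')%N -> (i' <= l < m)%N -> (0 < pop (weight P) i')%N ->
     arrival P (vpos P m) i' l <= T).

(** The clamp by [m.-1] covers the start of the sweep: at [i = m] the register already holds the
    capacity of the last edge. *)
Lemma bottleneck_step (R : realType) (P : dynpath R) (m i c : nat) :
  (i < m)%N -> bottleneck P m (minn i.+1 m.-1) c ->
  bottleneck P m (minn i m.-1) (minn c (capacity P i)).
Proof.
move=> lt_im [le_c [l0 [l0_in c_eq]]].
have -> : minn i m.-1 = i by lia.
split=> [l l_in|].
  have [->|ne_li] := eqVneq l i; first exact: geq_minr.
  by apply: leq_trans (geq_minl _ _) (le_c l _); lia.
have [_|_] := leqP c (capacity P i); last by exists i; split=> //; lia.
by exists l0; split=> //; lia.
Qed.

(** For fixed [i] the arrival terms differ only in the quotient, which is largest at the smallest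
    capacity; the terms for all [l] thus collapse into one. *)
Lemma scanned_step (R : realType) (P : dynpath R) (m i c : nat) (acc : R) :
  (i < m <= nedges P)%N -> bottleneck P m i c -> scanned P m i.+1 acc ->
  scanned P m i (if (0 < pop (weight P) i)%N then
    Num.max acc ((vpos P m - vpos P i) * tau P + ((pop (weight P) i).-1 %/ c)%:R)
    else acc).
Proof.
move=> /andP[lt_im le_mn] [le_c [l0 [/andP[le_il0 lt_l0m] c_eq]]] sc T.
have c_gt0 : (0 < c)%N by rewrite c_eq; apply/capacity_gt0/(leq_trans lt_l0m).
have -> : (forall i' l, (i <= i')%N -> (i' <= l < m)%N -> (0 < pop (weight P) i')%N ->
     arrival P (vpos P m) i' l <= T) <->
   ((0 < pop (weight P) i)%N ->
      (vpos P m - vpos P i) * tau P + ((pop (weight P) i).-1 %/ c)%:R <= T) /\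
   (forall i' l, (i.+1 <= i')%N -> (i' <= l < m)%N -> (0 < pop (weight P) i')%N ->
     arrival P (vpos P m) i' l <= T).
  split=> [arr|[arr_i arr] i' l].
    split=> [|i' l lt_ii']; last exact: arr (ltnW lt_ii').
    by rewrite c_eq; apply: arr => //; rewrite le_il0.
  rewrite leq_eqVlt => /orP[/eqP<-|]; last exact: arr.
  move=> l_in /arr_i; apply: le_trans; rewrite lerD2l ler_nat.
  by apply: leq_div2l => //; apply: le_c.
case: ifP => _; first rewrite ge_max; have := sc T.
  by move=> [H1 H2]; split=> [/andP[/H1[? ?] ?]|[? [? ?]]] //; apply/andP; split; auto.
by move=> [H1 H2]; split=> [/H1[? ?]|[? [_ ?]]] //; apply: H2.
Qed.

Lemma scanned_ThetaL (R : realType) (P : dynpath R) (m : nat) (acc : R) :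
  (m <= nedges P)%N -> scanned P m 0 acc -> acc = ThetaL P (vpos P m).
Proof.
move=> le_mn sc; apply: eq_upper_bounds => T; rewrite sc ThetaL_le; last first.
  by rewrite vpos_le.
split=> -[T_ge0 arr]; split=> // i l.
  move=> /andP[le_il lt_ln]; rewrite (vpos_lt (ltnW lt_ln) le_mn) => lt_lm.
  by apply: arr => //; rewrite le_il.
move=> _ /andP[le_il lt_lm]; have lt_ln := leq_trans lt_lm le_mn.
by apply: arr; rewrite ?le_il // (vpos_lt (ltnW lt_ln) le_mn).
Qed.

Definition same_outside (R : realType) (A B : seq nat) (s s' : store R) : Prop :=
  (forall a i, a \notin A -> nmem s' a i = nmem s a i) /\
  (forall a i, a \notin B -> rmem s' a i = rmem s a i).

(** The data that [ready] speaks of lies in natural arrays 0 to 5 and real arrays 0, 1 and 3, so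
    writes elsewhere preserve it. *)
Lemma ready_same (R : realType) (P : dynpath R) (A B : seq nat) (s s' : store R) :
  same_outside A B s s' -> all (leq 6) A -> all [predC mem [:: 0; 1; 3]%N] B ->
  ready P s -> ready P s'.
Proof.
move=> [eqn eqr] A6 B6 [s0 s1 sb].
have nA a : (a < 6)%N -> a \notin A.
  by move=> lt_a; apply/negP => /(allP A6); lia.
have nB a : a \in [:: 0; 1; 3]%N -> a \notin B.
  by move=> a_in; apply/negP => /(allP B6) /=; rewrite a_in.
split=> [||b]; rewrite ?eqn ?eqr ?nA ?nB //.
have [H1 H2 H3] := sb b.
by split=> i le_i; rewrite ?eqn ?eqr ?H1 ?H2 ?H3 ?nA ?nB //; case: (b).
Qed.

Lemma same_nstore (R : realType) (A B : seq nat) (s s' : store R) a i v :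
  a \in A -> same_outside A B s s' ->
  same_outside A B s (Store (upd (nmem s') a i v) (rmem s')).
Proof.
move=> aA [eqn eqr]; split=> // a' i' a'A /=; rewrite /upd.
by case: eqP a'A => [->|_ ?]; rewrite ?aA //= eqn.
Qed.

Lemma same_rstore (R : realType) (A B : seq nat) (s s' : store R) a i v :
  a \in B -> same_outside A B s s' ->
  same_outside A B s (Store (nmem s') (upd (rmem s') a i v)).
Proof.
move=> aB [eqn eqr]; split=> // a' i' a'B /=; rewrite /upd.
by case: eqP a'B => [->|_ ?]; rewrite ?aB //= eqr.
Qed.

Lemma runs_min (R : realType) (a i j c : nat) (s : store R) :
  nmem s i 0 = j -> nmem s 10 0 = c ->
  runs (If (NLe (NLoad a (nvar i)) (nvar 10)) (nset 10 (NLoad a (nvar i))) Skip) s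
    (fun s' k => (k <= 20)%N /\
       (s' = s /\ minn c (nmem s a j) = c \/
        s' = Store (upd (nmem s) 10 0 (minn c (nmem s a j))) (rmem s))).
Proof.
move=> si sc; apply: runs_if => /=; rewrite si sc.
case: leqP => [le_c|/ltnW le_c].
  by apply: runs_nstore; split=> //; right; rewrite /= si; congr Store; congr upd; lia.
by apply: runs_skip; split=> //; left; split=> //; apply/minn_idPl.
Qed.

Lemma scan_runs (R : realType) (P : dynpath R) (b : bool) (m : nat) (s : store R) :
  ready P s -> nmem s 11 0 = m -> (m <= nedges P)%N ->
  runs (scan b) s (fun s' k =>
    [/\ (k <= 200 * m.+1)%N, same_outside [:: 6; 10]%N [:: 6; aAcc b]%N s s' &
        rmem s' (aAcc b) 0 = ThetaL (side P b) (vpos (side P b) m)]).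
Proof.
move=> rdy sm le_mn.
have nside : nedges (side P b) = nedges P by case: (b).
have tside : tau (side P b) = tau P by case: (b).
have ne6' : (aAcc b == 6) = false by case: (b).
(* The loop counter is also the variant; the frame clause preserves [ready] and the vertex in cell
   11. *)
pose Inv i (s' : store R) := [/\ nmem s' 6 0 = i, (i <= m)%N,
   same_outside [:: 6; 10]%N [:: 6; aAcc b]%N s s',
   (0 < m)%N -> bottleneck (side P b) m (minn i m.-1) (nmem s' 10 0) &
   scanned (side P b) m i (rmem s' (aAcc b) 0)].
have rdyI s' : same_outside [:: 6; 10]%N [:: 6; aAcc b]%N s s' ->
    ready P s' /\ nmem s' 11 0 = m.
  by move=> eqs; split; [apply: ready_same eqs _ _ rdy => //; case: (b)|rewrite eqs.1].
do 3![apply: runs_seq; (apply: runs_nstore || apply: runs_rstore)].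
apply: runs_weaken; last first.
  apply: (@runs_while _ _ _ 100 Inv m) => [i0 s1 [s1i le_im eq1 bott sc]|].
    rewrite /= s1i => i0_gt0; split=> //; case: i0 i0_gt0 s1i le_im bott sc => // i _.
    move=> s1i lt_im bott sc; have m_gt0 : (0 < m)%N by apply: leq_trans lt_im.
    apply: runs_seq; apply: runs_nstore.
    have := @same_nstore _ [:: 6; 10]%N _ _ _ 6%N 0 i isT eq1.
    rewrite /= s1i subSS subn0; set s2 := Store _ _ => eq2.
    have s2i : nmem s2 6 0 = i by [].
    have [rdy2 s2m] := rdyI _ eq2.
    have [s20 s2t /(_ b)[spop2 scap2 spos2]] := rdy2.
    apply: runs_seq; apply: runs_weaken (runs_min (aCap b) s2i (erefl (nmem s2 10 0))).
    move=> s3 k3 [le_k3 H3].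
    have {H3} [s3i eq3 acc3 bott3] : [/\ nmem s3 6 0 = i,
        same_outside [:: 6; 10]%N [:: 6; aAcc b]%N s s3,
        rmem s3 = rmem s1 &
        bottleneck (side P b) m (minn i m.-1) (nmem s3 10 0)].
      have := bottleneck_step lt_im (bott m_gt0).
      rewrite -scap2; last exact: leq_trans lt_im le_mn.
      case: H3 => [[-> e]|-> bott']; first by rewrite -[nmem s1 10 0]/(nmem s2 10 0) e.
      by split=> //; apply: same_nstore.
    have [rdy3 s3m] := rdyI _ eq3.
    have [s30 s3t /(_ b)[spop3 scap3 spos3]] := rdy3.
    have le_in : (i <= nedges P)%N by apply: leq_trans (ltnW lt_im) le_mn.
    have := @scanned_step _ _ m i (nmem s3 10 0) _ _ _ sc.
    rewrite lt_im nside le_mn => /(_ isT).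
    have {1}<- : minn i m.-1 = i by lia.
    move=> /(_ bott3) {}sc.
    apply: runs_if; rewrite /= s3i addn1 spop3 //.
    have s3acc : rmem s3 (aAcc b) 0 = rmem s1 (aAcc b) 0 by rewrite acc3.
    case: ifP sc => _ sc; last first.
      by apply: runs_skip; split; [lia|split=> //; [lia|rewrite s3acc]].
    apply: runs_seq; apply: runs_rstore.
    rewrite /= s3m s3i addn1 spop3 // !spos3 // s3t subn1 -tside.
    have := @same_rstore _ _ [:: 6%N; aAcc b] _ _ 6%N 0
      ((vpos (side P b) m - vpos (side P b) i) * tau (side P b) +
       ((pop (weight (side P b)) i).-1 %/ nmem s3 10 0)%:R) isT eq3.
    set t := _ * _ + _ in sc *.
    set s4 := Store _ _ => eq4.
    apply: runs_if => /=; rewrite /upd eqxx /= ne6' /= s3acc.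
    case: leP sc => _ sc.
      apply: runs_rstore; split; first by case: (b) le_k3 => /=; lia.
      split=> //=.
      - lia.
      - by apply: (same_rstore (s' := s4)) => //; rewrite !inE eqxx orbT.
      - by rewrite /upd !eqxx.
    apply: runs_skip; split; first by case: (b) le_k3 => /=; lia.
    by split=> //=; [lia|rewrite /upd ne6' s3acc].
  have eq0 : same_outside [:: 6; 10]%N [:: 6; aAcc b]%N s s by [].
  have eqA := @same_nstore _ [:: 6; 10]%N _ _ _ 6%N 0 m isT eq0.
  have accB : aAcc b \in [:: 6; aAcc b]%N by rewrite !inE eqxx orbT.
  have eqB := @same_rstore _ _ _ _ _ (aAcc b) 0 0%:R accB eqA.
  rewrite /Inv /= sm; split=> //=.
  - exact: @same_nstore _ [:: 6; 10]%N _ _ _ 10%N 0 _ isT eqB.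
  - rewrite {1 2}/upd /= => m_gt0; rewrite /upd /= sm.
    have [_ _ /(_ b)[_ scap _]] := rdy; rewrite scap; last by lia.
    rewrite subn1; have -> : minn m m.-1 = m.-1 by lia.
    have -> : (aCap b == 6) = false by case: (b).
    split=> [l l_in|]; last by exists m.-1; split=> //; lia.
    by have -> : l = m.-1 by lia.
  (* At [i = m] there are no terms yet, so the accumulator 0 is correct. *)
  - rewrite /upd !eqxx /= => T; split=> [T_ge0|[]//]; split=> // i' l; lia.
move=> s' k [le_k bN [i [si _ eqs _ sc]]]; split=> //.
  by move: le_k; case: (b) => /=; lia.
move: bN sc; rewrite /= si -leqNgt leqn0 => /eqP->.
by apply: scanned_ThetaL; rewrite nside.
Qed.

(** * Preprocessing: prefix sums and the mirrored arrays *)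

(** One pass per vertex, relying on the initial zeros in the counter and in cell 0 of arrays 3 and
    4. The pass for the last vertex writes to array 5 outside the range of edges, hence the guard on
    capacities in the invariant below. *)
Definition setup : cmd :=
  While (NLe (nvar 6) (nvar 0))
    (Seq (NStore 3 (NAdd (nvar 6) (NConst 1))
            (NAdd (NLoad 3 (nvar 6)) (NLoad 1 (nvar 6))))
    (Seq (NStore 4 (NAdd (nvar 6) (NConst 1))
            (NAdd (NLoad 4 (nvar 6)) (NLoad 1 (NSub (nvar 0) (nvar 6)))))
    (Seq (NStore 5 (nvar 6)
            (NLoad 2 (NSub (nvar 0) (NAdd (nvar 6) (NConst 1)))))
    (Seq (RStore 3 (nvar 6)
            (RSub (ROfNat (NConst 0)) (RLoad 1 (NSub (nvar 0) (nvar 6)))))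
         (nset 6 (NAdd (nvar 6) (NConst 1))))))).

Lemma setup_runs (R : realType) (P : dynpath R) :
  runs setup (input P) (fun s k => (k <= 100 * (nverts P).+1)%N /\ ready P s).
Proof.
pose Inv r (s : store R) := exists i, [/\ (r = (nedges P).+1 - i)%N,
  (i <= (nedges P).+1)%N & nmem s 6 0 = i] /\
  [/\ forall a j, (a < 3)%N -> nmem s a j = nmem (input P) a j,
      forall a j, (a < 2)%N -> rmem s a j = rmem (input P) a j,
      forall b j, (j <= i)%N ->
        nmem s (aPop b) j = \sum_(0 <= l < j) weight (side P b) l &
      forall j, (j < i)%N ->
        ((j < nedges P)%N -> nmem s 5 j = capacity (mirror P) j) /\
        rmem s 3 j = vpos (mirror P) j]%N.
apply: runs_weaken; last first.
  apply: (@runs_while _ _ _ 60 Inv (nedges P).+1) => [r s [i [[er le_i si] [sn sr sp sm]]]|].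
    rewrite /= si sn //= => le_in; split; first by lia.
    do 4!(apply: runs_seq; (apply: runs_nstore || apply: runs_rstore)).
    apply: runs_nstore; split=> //.
    rewrite /Inv; exists i.+1; split; first by split; [lia|lia|rewrite /upd /= si addn1].
    split.
    - by move=> [|[|[|a]]] j lt_a //=; rewrite /upd /= sn.
    - by move=> [|[|a]] j lt_a //=; rewrite /upd /= sr.
    - move=> b j le_j /=; rewrite /upd /= si.
      case: b (sp b) => sp' /=; rewrite addn1.
        case: eqP => [->|ne_j]; last by rewrite sp' //; lia.
        by rewrite sp' // big_nat_recr //= sn.
      case: eqP => [->|ne_j]; last by rewrite sp' //; lia.
      by rewrite sp' // big_nat_recr //= !sn // weight_mirror.
    - move=> j le_j /=; rewrite /upd /= si addn1.
      case: eqP => [->|ne_j]; last by apply: sm; lia.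
      rewrite !sn // sr //; split=> [lt_in|]; first by rewrite capacity_mirror.
      by rewrite vpos_mirror // sub0r.
  exists 0%N; do 2!split=> //.
  by move=> [] [|j] // _; rewrite big_geq //= nth_nil.
move=> s k [le_k bN [_ [i [[_ le_i si] [sn sr sp sm]]]]].
have ei : i = (nedges P).+1 by move: bN; rewrite /= si sn //=; lia.
split; first by move: le_k; rewrite /nverts /=; lia.
split=> [||b]; rewrite ?sn ?sr //; split.
- by move=> j le_j; rewrite sp ?ei.
- move=> j le_j; case: b => /=; first by rewrite sn.
  by have [|e _] := sm j; [lia|rewrite e].
- move=> j le_j; case: b => /=; first by rewrite sr.
  by have [|_ e] := sm j; [lia|rewrite e].
Qed.

(** * Binary search for the crossing edge *)

(** Two vertices are allowed because the last stage needs [ThetaL] at the right end and [ThetaR] at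
    the left end of an edge; the search passes its midpoint twice. *)
Definition probe (p q : nat) : cmd :=
  Seq (nset 11 (nvar q)) (Seq (scan true)
  (Seq (nset 11 (NSub (nvar 0) (nvar p))) (scan false))).

(** Register [p] is read only after the first sweep, so it must not be one that the sweep
    overwrites. *)
Lemma probe_runs (R : realType) (P : dynpath R) (s : store R) (p q lo hi : nat) :
  p \notin [:: 6; 10; 11]%N -> ready P s -> nmem s p 0 = lo -> nmem s q 0 = hi ->
  (lo <= nedges P)%N -> (hi <= nedges P)%N ->
  runs (probe p q) s (fun s' k => [/\ (k <= 500 * nverts P)%N,
    same_outside [:: 6; 10; 11]%N [:: 4; 5; 6]%N s s',
    rmem s' 4 0 = ThetaL P (vpos P hi) & rmem s' 5 0 = ThetaR P (vpos P lo)]).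
Proof.
move=> pN rdy slo shi le_lo le_hi.
have eq0 : same_outside [:: 6; 10; 11]%N [:: 4; 5; 6]%N s s by [].
have eq1 := @same_nstore _ [:: 6; 10; 11]%N _ _ _ 11%N 0 hi isT eq0.
apply: runs_seq; apply: runs_nstore; rewrite /= shi.
have rdy1 := ready_same eq1 isT isT rdy.
apply: runs_seq; apply: runs_weaken (@scan_runs _ _ true hi _ rdy1 _ le_hi) => //.
move=> s2 k2 [le_k2 eq2 s2A].
have [eq2n eq2r] : same_outside [:: 6; 10; 11]%N [:: 4; 5; 6]%N s s2.
  case: eq1 => eq1n eq1r; case: eq2 => eq2n eq2r.
  split=> a i aN; [rewrite eq2n ?eq1n // | rewrite eq2r ?eq1r //];
  by apply: contra aN; rewrite !inE => /orP[]/eqP->.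
have [s20 _ _] := ready_same (conj eq2n eq2r) isT isT rdy.
apply: runs_seq; apply: runs_nstore; rewrite /= s20 eq2n // slo.
have eq3 := @same_nstore _ [:: 6; 10; 11]%N _ _ _ 11%N 0 (nedges P - lo)%N isT (conj eq2n eq2r).
have rdy3 := ready_same eq3 isT isT rdy.
apply: runs_weaken (@scan_runs _ _ false (nedges P - lo) _ rdy3 _ _) => //; last exact: leq_subr.
move=> s4 k4 [le_k4 eq4 s4A]; split.
- by rewrite /nverts; lia.
- case: eq3 => eq3n eq3r; case: eq4 => eq4n eq4r.
  split=> a i aN; [rewrite eq4n ?eq3n // | rewrite eq4r ?eq3r //];
  by apply: contra aN; rewrite !inE => /orP[]/eqP->.
- by rewrite eq4.2.
- by rewrite [LHS]s4A /= vpos_mirror ?leq_subr // subKn // -ThetaR_mirror.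
Qed.

Definition search : cmd :=
  Seq (nset 7 (NConst 0))
  (Seq (nset 8 (nvar 0))
  (While (BNot (NLe (nvar 8) (NAdd (nvar 7) (NConst 1))))
    (Seq (nset 9 (NDiv (NAdd (nvar 7) (nvar 8)) (NConst 2)))
    (Seq (probe 9 9)
         (If (RLe (rvar 4) (rvar 5)) (nset 7 (nvar 9)) (nset 8 (nvar 9))))))).

Lemma search_runs (R : realType) (P : dynpath R) (s : store R) :
  ready P s ->
  runs search s (fun s' k =>
    [/\ (k <= 700 * (nverts P * (trunc_log 2 (nverts P)).+2))%N, ready P s' &
     exists lo hi, [/\ (lo <= hi <= lo.+1)%N, (hi <= nedges P)%N,
       nmem s' 7 0 = lo /\ nmem s' 8 0 = hi,
       ThetaL P (vpos P lo) <= ThetaR P (vpos P lo) &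
       ThetaR P (vpos P hi) <= ThetaL P (vpos P hi)]]).
Proof.
move=> rdy; have le_0n : vpos P 0 <= vpos P (nedges P) by rewrite vpos_le.
(* The comparisons at the two ends bracket a crossing, and [r] bounds the halvings left. The guard
   forces a width of at least 2, hence [0 < r]. *)
pose Inv r (s : store R) := ready P s /\ exists lo hi,
  [/\ (lo <= hi <= nedges P)%N, (hi - lo <= 2 ^ r)%N,
      nmem s 7 0 = lo /\ nmem s 8 0 = hi,
      ThetaL P (vpos P lo) <= ThetaR P (vpos P lo) &
      ThetaR P (vpos P hi) <= ThetaL P (vpos P hi)].
have eq0 : same_outside [:: 6; 7; 8; 9; 10; 11]%N [:: 4; 5; 6]%N s s by [].
have eq1 := @same_nstore _ [:: 6; 7; 8; 9; 10; 11]%N _ _ _ 7%N 0 0%N isT eq0.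
have eq2 := @same_nstore _ [:: 6; 7; 8; 9; 10; 11]%N _ _ _ 8%N 0 (nedges P) isT eq1.
have rdy2 := ready_same eq2 isT isT rdy.
do 2![apply: runs_seq; apply: runs_nstore].
apply: runs_weaken; last first.
  apply: (@runs_while _ _ _ (600 * nverts P) Inv (trunc_log 2 (nverts P)).+1).
    move=> r s1 [rdy1 [lo [hi [/andP[le_lohi le_hi] le_r [slo shi] LRlo RLhi]]]].
    rewrite /= slo shi => lt_lohi.
    have r_gt0 : (0 < r)%N by case: r le_r => // ; rewrite expn0; lia.
    split=> //.
    pose mid := ((lo + hi) %/ 2)%N.
    have [lt_lomid lt_midhi] : (lo < mid < hi)%N /\ (mid - lo <= 2 ^ r.-1)%N &&
        (hi - mid <= 2 ^ r.-1)%N.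
      by move: le_r; rewrite -{1}(prednK r_gt0) expnS /mid; lia.
    have le_mid : (mid <= nedges P)%N by lia.
    apply: runs_seq; apply: runs_nstore; rewrite /= slo shi -/mid.
    have eq00 : same_outside [:: 6; 9; 10; 11]%N [:: 4; 5; 6]%N s1 s1 by [].
    have eq3 := @same_nstore _ [:: 6; 9; 10; 11]%N _ _ _ 9%N 0 mid isT eq00.
    have rdy3 := ready_same eq3 isT isT rdy1.
    apply: runs_seq.
    apply: runs_weaken (@probe_runs _ _ _ 9 9 mid mid isT rdy3 (erefl _) (erefl _) le_mid le_mid).
    move=> s4 k4 [le_k4 eq4 s4L s4R].
    have rdy4 := ready_same eq4 isT isT rdy3.
    have s47 : nmem s4 7 0 = lo by rewrite eq4.1.
    have s48 : nmem s4 8 0 = hi by rewrite eq4.1.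
    have s49 : nmem s4 9 0 = mid by rewrite eq4.1.
    have eq40 : same_outside [:: 7; 8]%N [:: 4; 5; 6]%N s4 s4 by [].
    have rdy5 a : a \in [:: 7; 8]%N ->
        ready P (Store (upd (nmem s4) a 0 mid) (rmem s4)).
      move=> a_in; have eq5 := @same_nstore _ _ _ _ _ a 0 mid a_in eq40.
      exact: ready_same eq5 isT isT rdy4.
    apply: runs_if => /=; rewrite s4L s4R; case: leP => [LRm|/ltW RLm].
      apply: runs_nstore; rewrite /= s49; split; first by rewrite /nverts in le_k4 *; lia.
      split; first exact: rdy5.
      by exists mid, hi; split=> //; lia.
    apply: runs_nstore; rewrite /= s49; split; first by rewrite /nverts in le_k4 *; lia.
    split; first exact: rdy5.
    by exists lo, mid; split=> //; lia.
  have [s0 _ _] := rdy; rewrite /= /upd /= s0.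
  split=> //; exists 0%N, (nedges P); split=> //.
  - by rewrite leqnn.
  - by rewrite subn0; apply/ltnW/ltnW/trunc_log_ltn.
  - by rewrite ThetaL_first ThetaR_ge0.
  - by rewrite ThetaR_last ThetaL_ge0.
move=> s' k [le_k bN [r [rdy' [lo [hi [/andP[le_lohi le_hi] _ [slo shi] LRlo RLhi]]]]]].
split=> //.
  move: le_k => /=; rewrite /nverts; move: (trunc_log _ _) => L; nia.
exists lo, hi; split=> //; move: bN; rewrite /= slo shi negbK addn1 => ->.
by rewrite le_lohi.
Qed.

Definition rtwo : rexpr := ROfNat (NConst 2).
Definition gap : rexpr :=
  RMul (RSub (RLoad 1 (nvar 8)) (RLoad 1 (nvar 7))) (rvar 0).

(** Follows the branches of [edge_opt]; the final test implements the truncation at 0. *)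
Definition finish : cmd :=
  Seq (probe 7 8)
  (If (RLe (RAdd (rvar 5) gap) (rvar 4))
    (Seq (rset 2 (rvar 5)) (RStore 2 (NConst 1) (RLoad 1 (nvar 7))))
  (If (RLe (RAdd (rvar 4) gap) (rvar 5))
    (Seq (rset 2 (rvar 4)) (RStore 2 (NConst 1) (RLoad 1 (nvar 8))))
    (Seq (rset 2 (RDiv (RSub (RAdd (rvar 4) (rvar 5)) gap) rtwo))
    (Seq (RStore 2 (NConst 1)
           (RDiv (RAdd (RAdd (RDiv (RSub (rvar 5) (rvar 4)) (rvar 0))
                             (RLoad 1 (nvar 7)))
                       (RLoad 1 (nvar 8)))
                 rtwo))
         (If (RLe (rvar 2) (ROfNat (NConst 0)))
             (rset 2 (ROfNat (NConst 0))) Skip))))).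

Lemma finish_runs (R : realType) (P : dynpath R) (s : store R) (lo hi : nat) :
  ready P s -> nmem s 7 0 = lo -> nmem s 8 0 = hi ->
  (lo <= nedges P)%N -> (hi <= nedges P)%N ->
  runs finish s (fun s' k => (k <= 700 * nverts P)%N /\
    (out_time s', out_sink s') =
    edge_opt (vpos P lo) (vpos P hi) (tau P)
      (ThetaL P (vpos P hi)) (ThetaR P (vpos P lo))).
Proof.
move=> rdy slo shi le_lo le_hi.
apply: runs_seq; apply: runs_weaken (@probe_runs _ _ _ 7 8 lo hi isT rdy slo shi le_lo le_hi).
move=> s1 k1 [le_k1 eq1 s1A s1B].
have [_ st /(_ true)[_ _ spos]] := ready_same eq1 isT isT rdy.
have slo1 : nmem s1 7 0 = lo by rewrite eq1.1.
have shi1 : nmem s1 8 0 = hi by rewrite eq1.1.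
rewrite /= in spos; have sa := spos _ le_lo; have sb := spos _ le_hi.
rewrite /edge_opt -s1A -s1B -st -sa -sb.
have cost c : (c <= 200)%N -> (k1 + c <= 700 * nverts P)%N.
  by rewrite /nverts in le_k1 *; lia.
apply: runs_if; rewrite /= slo1 shi1; case: ifP => _.
  apply: runs_seq; do 2!apply: runs_rstore; split; first exact: cost.
  by rewrite /out_time /out_sink /upd /= slo1.
apply: runs_if; rewrite /= slo1 shi1; case: ifP => _.
  apply: runs_seq; do 2!apply: runs_rstore; split; first exact: cost.
  by rewrite /out_time /out_sink /upd /= shi1.
apply: runs_seq; apply: runs_rstore; apply: runs_seq; apply: runs_rstore.
apply: runs_if; rewrite /= /upd /= slo1 shi1; case: leP => _.
  apply: runs_rstore; split; first exact: cost.
  by rewrite /out_time /out_sink /upd /=.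
apply: runs_skip; split; first exact: cost.
by rewrite /out_time /out_sink /upd /=.
Qed.

(** * The complete algorithm and its running time *)

Theorem theorem2 (R : realType) :
  exists (prog : cmd) (C : nat), forall P : dynpath R,
  exists (s : store R) (k : nat),
    [/\ exec prog (input P) s k,
        (k <= C * (nverts P * trunc_log 2 (nverts P)).+1)%N,
        out_time s = Theta1 P,
        vpos P 0 <= out_sink s <= vpos P (nedges P)
      & Theta1 P = Num.max (ThetaL P (out_sink s)) (ThetaR P (out_sink s))].
Proof.
(* With [N] vertices and [L] their truncated logarithm the stages cost at most
   [700 * N * L + 2200 * N + 100], and [N <= N * L + 1] absorbs the linear term. *)
exists (Seq setup (Seq search finish)), 5000%N => P.
suff [s [k [E [le_k ot y_in Ty]]]] : runs (Seq setup (Seq search finish)) (input P)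
    (fun s k => [/\ (k <= 5000 * (nverts P * trunc_log 2 (nverts P)).+1)%N,
       out_time s = Theta1 P, vpos P 0 <= out_sink s <= vpos P (nedges P)
     & Theta1 P = Theta P (out_sink s)]) by exists s, k.
apply: runs_seq; apply: runs_weaken (setup_runs P) => s1 k1 [le_k1 rdy1].
apply: runs_seq; apply: runs_weaken (search_runs rdy1) => s2 k2 [le_k2 rdy2].
move=> [lo [hi [le_lohi le_hi [slo shi] LRlo RLhi]]].
have le_lo : (lo <= nedges P)%N by lia.
apply: runs_weaken (finish_runs rdy2 slo shi le_lo le_hi) => s3 k3 [le_k3 out3].
have := edge_optP le_lohi le_hi LRlo RLhi; rewrite -out3 /= => -[y_in Ty T1].
split=> //; last by rewrite Ty.
(* The logarithm is positive from two vertices on; for a single vertex the added 1 is what makes the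
   bound hold. *)
have N_NL : (nverts P <= (nverts P * trunc_log 2 (nverts P)).+1)%N.
  have [lt_1N|] := ltnP 1 (nverts P); last by lia.
  by rewrite leqW // leq_pmulr // trunc_log_gt0.
move: le_k1 le_k2 le_k3 N_NL; rewrite 2!(mulnS (nverts P)).
move: (nverts P) (nverts P * _)%N => N NL; lia.
Qed.
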